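(* Let $R$ be a commutative ring with unit and $(A,(\mu_n)_{n\in\mathbb N})$ an $A_\infty$-algebra over $R$. Then the Hochschild cup product $\cup:CH^*(A)\otimes CH^*(A)\to CH^*(A)$ is a chain map of degree zero; that is, for homogeneous $f,g\in CH^*(A)$ one has $\deg(f\cup g)=\deg f+\deg g$ and $$\beta(f\cup g)=\beta(f)\cup g+(-1)^{\deg f}f\cup\beta(g),$$ where $\beta$ is the Hochschild codifferential on $CH^*(A)$.
   Context: Conventions: $\mathbb N=\{1,2,\dots\}$, $\mathbb N_0=\mathbb N\cup\{0\}$, $\otimes=\otimes_R$, graded modules are $\mathbb Z$-graded, empty sums are $0$. Formulas containing signs are stated for homogeneous elements and extended $R$-linearly. For $a\in A_j$ write $\mu(a)=j$ and $\|a\|=\mu(a)-1$. For $a_1,\dots,a_n\in A$ put $\maltese_i^j=\sum_{q=i}^j\|a_q\|$ for $1\le i\le j\le n$ ($0$ if $j<i$). $A_\infty$-algebra: a graded $R$-module $A=\bigoplus_j A_j$ with graded $R$-module homomorphisms $\mu_n:A^{\otimes n}\to A$ of degree $2-n$ ($n\in\mathbb N$) such that for all $r\in\mathbb N$ and $a_1,\dots,a_r\in A$ $$\sum_{n_1,n_2\in\mathbb N,\ n_1+n_2=r+1}\ \sum_{i=1}^{r+1-n_1}(-1)^{\maltese_1^{i-1}}\mu_{n_2}(a_1,\dots,a_{i-1},\mu_{n_1}(a_i,\dots,a_{i+n_1-1}),a_{i+n_1},\dots,a_r)=0.$$ Hochschild cochain complex $CH^*(A)$: its elements are families $(f_n)_{n\in\mathbb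 N_0}$ with $f_n\in\mathrm{Hom}^*(A^{\otimes n},A)$ (graded $R$-module homomorphisms), and the family lies in $CH^j(A)$, written $\deg f=j$, iff for all $n$ and all homogeneous $b_1,\dots,b_n$ the element $f_n(b_1,\dots,b_n)$ is homogeneous of index $\mu(f_n(b_1,\dots,b_n))=\sum_{q=1}^n\mu(b_q)+j-n$ (or zero). Thus $CH^j(A)=\prod_{n\ge0}\mathrm{Hom}^{j-n}(A^{\otimes n},A)$. The codifferential $\beta$ has degree $+1$, satisfies $\beta\circ\beta=0$, and is defined for $f\in\mathrm{Hom}^*(A^{\otimes n},A)$ by letting the $\mathrm{Hom}^*(A^{\otimes(n+l)},A)$-component of $\beta(f)$, $l\in\mathbb N_0$, be $$(\beta(f))_l(a_1,\dots,a_{n+l})=\sum_{i=1}^n(-1)^{\maltese_1^{i-1}}f(a_1,\dots,a_{i-1},\mu_{l+1}(a_i,\dots,a_{i+l}),a_{i+l+1},\dots,a_{n+l})$$ $$+\sum_{i=1}^{l+1}(-1)^{(\deg f-1)(\maltese_1^{i-1}+1)+1}\mu_{l+1}(a_1,\dots,a_{i-1},f(a_i,\dots,a_{n+i-1}),a_{n+i},\dots,a_{n+l}),$$ and for $f=(f_n)_n$ the component of $\beta(f)$ in $\mathrm{Hom}^*(A^{\otimes N},A)$ is $\sum_{n+l=N}(\beta(f_n))_l$. Hochschild cup product: for $f\in\mathrm{Hom}^*(A^{\otimes m},A)$, $g\in\mathrm{Hom}^*(A^{\otimes n},A)$ with $m,n\in\mathbb N_0$, and for $k\in\mathbb N_0$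 and $j_1,j_2\in\mathbb N$ with $1\le j_1\le n+k$, $j_1+m\le j_2\le m+k+1$, define $f\cup_{k,j_1,j_2}g\in\mathrm{Hom}^*(A^{\otimes(m+n+k)},A)$ by $$(f\cup_{k,j_1,j_2}g)(a_1,\dots,a_{m+n+k})=(-1)^{\mho_{j_1,j_2}}\mu_{k+2}\big(a_1,\dots,a_{j_1-1},f(a_{j_1},\dots,a_{j_1+m-1}),a_{j_1+m},\dots,a_{j_2-1},g(a_{j_2},\dots,a_{j_2+n-1}),a_{j_2+n},\dots,a_{m+n+k}\big),$$ $$\mho_{j_1,j_2}=(\deg f-1)\cdot\maltese_1^{j_1-1}+(\deg g-1)\cdot(\maltese_1^{j_2-1}+\deg f).$$ Put $f\cup^{m,n}g=\sum_{k\in\mathbb N_0}\sum_{j_1=1}^{n+k}\sum_{j_2=j_1+m}^{m+k+1}f\cup_{k,j_1,j_2}g\in\prod_{k\ge0}\mathrm{Hom}^*(A^{\otimes(m+n+k)},A)$ and, for $f=(f_m)_m$, $g=(g_n)_n$ in $CH^*(A)$, $f\cup g=\sum_{m,n\in\mathbb N_0}f_m\cup^{m,n}g_n$ (each component is a finite sum). The tensor product $CH^*(A)\otimes CH^*(A)$ carries the product grading and the differential $f\otimes g\mapsto\beta(f)\otimes g+(-1)^{\deg f}f\otimes\beta(g)$.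
   Formalization: In the cup product, j1 runs over 1..k+1 instead of 1..n+k; the two agree for n≥1, but for n=0 the literal range drops the terms with j1=k+1, and the identity then fails (e.g. f=1, g non-central in an associative unital algebra in degree 0). *)

(* Defs.v *)
From HB Require Import structures.
From mathcomp Require Import all_boot all_order all_algebra finmap.

Set Implicit Arguments.
Unset Strict Implicit.
Unset Printing Implicit Defensive.

Import GRing.Theory.
Local Open Scope fset_scope.
Local Open Scope ring_scope.

(* A = \bigoplus_j A_j, internally: [ghom j] is the submodule A_j, and [gdec]
   is a two-sided inverse of the summation map from the finitely supported
   families (b_j)_j with b_j \in A_j to A. *)
Record gradedModule (R : comPzRingType) := GradedModule {
  gcarrier :> lmodType R;
  ghom : int -> submodClosed gcarrier;
  gdec : gcarrier -> {fsfun int -> gcarrier with 0};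
  gdec_hom : forall a j, gdec a j \in ghom j;
  gdec_sum : forall a, \sum_(j <- finsupp (gdec a)) gdec a j = a;
  gdec_uniq : forall b : {fsfun int -> gcarrier with 0},
    (forall j, b j \in ghom j) -> gdec (\sum_(j <- finsupp b) b j) = b
}.

Section Graded.
Variables (R : comPzRingType) (A : gradedModule R).

(* (-1)^z; [R] need not be a unit ring, so [exprz] is unavailable. *)
Definition sgnz (z : int) : R := (-1) ^+ `|z|%N.

(* A list [t : seq (int * A)] stands for a list of homogeneous elements, each
   paired with its degree: the degree cannot be read off the element 0. *)
Definition homogeneous (t : seq (int * A)) : bool :=
  all (fun x => x.2 \in ghom A x.1) t.

Definition totdeg (t : seq (int * A)) : int := \sum_(x <- t) x.1.

(* \maltese_1^i *)
Definition maltese (t : seq (int * A)) (i : nat) : int :=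
  \sum_(x <- take i t) (x.1 - 1).

(* Indices are shifted by one with respect to a_1, ..., a_r: [slice i n a] is
   a_{i+1}, ..., a_{i+n}. *)
Definition slice (T : Type) (i n : nat) (a : seq T) : seq T :=
  take n (drop i a).

(* A family (f_n)_n of maps f_n : A^n -> A is encoded as a single
   [f : seq A -> A], f_n being its restriction to lists of size n; linear maps
   on the tensor power A^{\otimes n} are multilinear maps on A^n. *)
Definition multilinear (n : nat) (f : seq A -> A) : Prop :=
  forall (s1 s2 : seq A) (c : R) (x y : A), (size s1 + size s2).+1 = n ->
    f (s1 ++ (c *: x + y) :: s2) = c *: f (s1 ++ x :: s2) + f (s1 ++ y :: s2).

(* f_n \in Hom^e(A^{\otimes n}, A) *)
Definition Hom (e : int) (n : nat) (f : seq A -> A) : Prop :=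
  multilinear n f /\
  forall t, size t = n -> homogeneous t -> f (unzip2 t) \in ghom A (totdeg t + e).

(* (f_n)_n \in CH^j(A) *)
Definition CH (j : int) (f : seq A -> A) : Prop :=
  forall n : nat, Hom (j - n%:Z) n f.

(* Extends multilinearly to all of A^n a formula that is given on homogeneous
   elements and may involve their degrees: each argument is replaced by the
   sum of its homogeneous components. *)
Fixpoint linext (F : seq (int * A) -> A) (a : seq A) : A :=
  if a is x :: a' then
    \sum_(j <- finsupp (gdec x)) linext (fun t => F ((j, gdec x j) :: t)) a'
  else F [::].

Lemma gdec_homE j (x : A) : x \in ghom A j -> x != 0 ->
  gdec x = [fsfun i in [fset j] => x | 0] :> {fsfun int -> A with 0}.
Proof.
move=> xj x_neq0; set b := (RHS).
have bE i : b i = if i == j then x else 0 by rewrite fsfunE inE.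
have bj : finsupp b = [fset j].
  by apply/fsetP => i; rewrite mem_finsupp bE inE; case: (i =P j); rewrite ?eqxx.
have b_hom i : b i \in ghom A i by rewrite bE; case: (i =P j) => [->//|_]; exact: rpred0.
by rewrite -[RHS](gdec_uniq b_hom) bj big_seq_fset1 bE eqxx.
Qed.

Lemma gdec0 : gdec (0 : A) = [fsfun].
Proof.
rewrite -[RHS]gdec_uniq => [|j]; last by rewrite fsfunE; exact: rpred0.
by rewrite finsupp0 big_seq_fset0.
Qed.

Lemma eq_linext F G a : F =1 G -> linext F a = linext G a.
Proof.
elim: a F G => [|x a IHa] F G eqFG /=; first exact: eqFG.
by apply: eq_bigr => j _; apply: IHa => t.
Qed.

(* [linext F] agrees with [F] on homogeneous elements, provided that [F]
   vanishes as soon as one of its arguments is 0. *)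
Lemma linextE F (t : seq (int * A)) :
    (forall u, homogeneous u -> 0 \in unzip2 u -> F u = 0) ->
  homogeneous t -> linext F (unzip2 t) = F t.
Proof.
elim: t F => [//|[j x] t IHt] F F0 /= /andP[xj ht].
have [->|x_neq0] := eqVneq x 0.
  rewrite [RHS]F0 ?mem_head //=; last by rewrite rpred0.
  by rewrite gdec0 finsupp0 big_seq_fset0.
rewrite (gdec_homE xj x_neq0); set b := [fsfun _ in _ => _ | _].
have bj : b j = x by rewrite fsfunE inE eqxx.
have -> : finsupp b = [fset j].
  by apply/fsetP => i; rewrite mem_finsupp fsfunE !inE; case: (i =P j); rewrite ?eqxx.
rewrite big_seq_fset1 bj IHt // => u hu u0; apply: F0 => /=.
  by rewrite xj hu.
by rewrite inE u0 orbT.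
Qed.

Lemma linext_linear c F G a :
  linext (fun t => c *: F t + G t) a = c *: linext F a + linext G a.
Proof.
elim: a F G => [//|x a IHa] F G /=.
by rewrite scaler_sumr -big_split; apply: eq_bigr => j _; rewrite IHa.
Qed.

End Graded.

(* The operations mu_n, n >= 1, are bundled as one [mu : seq A -> A] as above;
   the value of [mu] on the empty list is irrelevant. *)
Record ainfAlgebra (R : comPzRingType) := AinfAlgebra {
  ainf_module :> gradedModule R;
  mu : seq ainf_module -> ainf_module;
  mu_hom : forall n : nat, (0 < n)%N -> Hom (2 - n%:Z) n mu;
  mu_ainf : forall t : seq (int * ainf_module), (0 < size t)%N ->
    homogeneous t ->
    let r := size t in let a := unzip2 t in
    \sum_(1 <= n1 < r.+1) \sum_(0 <= i < r.+1 - n1)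
      sgnz R (maltese t i) *:
        mu (take i a ++ mu (slice i n1 a) :: drop (i + n1) a) = 0
}.

Section Hochschild.
Variables (R : comPzRingType) (A : ainfAlgebra R).
Implicit Types (p q : int) (f g : seq A -> A) (a : seq A).

(* The component (beta f)_l for f \in Hom^*(A^{\otimes n}, A) of degree p in
   CH^*(A), on homogeneous elements. *)
Definition beta_comp p (n l : nat) f (t : seq (int * A)) : A :=
  let a := unzip2 t in
  \sum_(0 <= i < n)
     sgnz R (maltese t i) *:
       f (take i a ++ mu (slice i l.+1 a) :: drop (i + l.+1) a)
  + \sum_(0 <= i < l.+1)
     sgnz R ((p - 1) * (maltese t i + 1) + 1) *:
       mu (take i a ++ f (slice i n a) :: drop (i + n) a).

(* The codifferential on CH^p(A). *)
Definition beta p f a : A :=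
  let N := size a in
  \sum_(0 <= n < N.+1) linext (beta_comp p n (N - n) f) a.

(* f \cup_{k,j1+1,j2+1} g for f \in Hom^*(A^{\otimes m}, A) of degree p in
   CH^*(A) and g \in Hom^*(A^{\otimes n}, A) of degree q in CH^*(A), on
   homogeneous elements; k = size t - m - n. *)
Definition cup_term p q (m n j1 j2 : nat) f g (t : seq (int * A)) : A :=
  let a := unzip2 t in
  sgnz R ((p - 1) * maltese t j1 + (q - 1) * (maltese t j2 + p)) *:
    mu (take j1 a ++ f (slice j1 m a) ::
        slice (j1 + m) (j2 - (j1 + m)) a ++ g (slice j2 n a) ::
        drop (j2 + n) a).

(* The range of j1 is that of all positions for which the range of j2 is
   nonempty, i.e. 1 <= j1 <= k + 1 in one-based indexing.  For n >= 1 the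
   bound j1 <= n + k describes the same pairs (j1, j2) (see [cup_rangeE]);
   for n = 0 it would drop j1 = k + 1, i.e. the terms
   mu_{k+2}(a_1, ..., a_k, f(...), g()), without which the cup product with
   elements of A = Hom(A^{\otimes 0}, A) is not a chain map. *)
Definition cup_comp p q (m n k : nat) f g (t : seq (int * A)) : A :=
  \sum_(0 <= j1 < k.+1) \sum_(j1 + m <= j2 < m + k.+1)
    cup_term p q m n j1 j2 f g t.

(* The cup product CH^p(A) x CH^q(A) -> CH^{p+q}(A). *)
Definition cup p q f g a : A :=
  let N := size a in
  \sum_(0 <= m < N.+1) \sum_(0 <= n < (N - m).+1)
    linext (cup_comp p q m n (N - m - n) f g) a.

Lemma cup_rangeE p q (m n k : nat) f g (t : seq (int * A)) : (0 < n)%N ->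
  cup_comp p q m n k f g t =
  \sum_(0 <= j1 < n + k) \sum_(j1 + m <= j2 < m + k.+1)
    cup_term p q m n j1 j2 f g t.
Proof.
move=> n_gt0; have le_kn : (k.+1 <= n + k)%N by rewrite -add1n leq_add2r.
rewrite [RHS](big_cat_nat (leq0n _) le_kn) /= [X in _ = _ + X]big_nat_cond.
rewrite [X in _ = _ + X]big1 ?addr0 // => j1 /andP[/andP[le_k1 _] _].
by rewrite big_geq // addnC leq_add2r.
Qed.

Lemma mu_linear (s1 s2 : seq A) c x y :
  mu (s1 ++ (c *: x + y) :: s2) = c *: mu (s1 ++ x :: s2) + mu (s1 ++ y :: s2).
Proof. by have [mu_lin _] := @mu_hom R A _ (ltn0Sn (size s1 + size s2)); apply: mu_lin. Qed.

(* By bilinearity, cup induces a map CH^p(A) \otimes CH^q(A) -> CH^{p+q}(A). *)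
Lemma cup_linearl p q c f1 f2 g a :
  cup p q (fun b => c *: f1 b + f2 b) g a
  = c *: cup p q f1 g a + cup p q f2 g a.
Proof.
rewrite /cup scaler_sumr -big_split; apply: eq_bigr => m _.
rewrite scaler_sumr -big_split; apply: eq_bigr => n _ /=.
rewrite -linext_linear; apply: eq_linext => t.
rewrite /cup_comp scaler_sumr -big_split; apply: eq_bigr => j1 _ /=.
rewrite scaler_sumr -big_split; apply: eq_bigr => j2 _ /=.
rewrite /cup_term /= scalerA [c * _]mulrC -scalerA -scalerDr; congr (_ *: _).
exact: mu_linear.
Qed.

Lemma cup_linearr p q c f g1 g2 a :
  cup p q f (fun b => c *: g1 b + g2 b) a
  = c *: cup p q f g1 a + cup p q f g2 a.
Proof.
rewrite /cup scaler_sumr -big_split; apply: eq_bigr => m _.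
rewrite scaler_sumr -big_split; apply: eq_bigr => n _ /=.
rewrite -linext_linear; apply: eq_linext => t.
rewrite /cup_comp scaler_sumr -big_split; apply: eq_bigr => j1 _ /=.
rewrite scaler_sumr -big_split; apply: eq_bigr => j2 _ /=.
rewrite /cup_term /= scalerA [c * _]mulrC -scalerA -scalerDr; congr (_ *: _).
by rewrite -!cat_cons !catA mu_linear.
Qed.

End Hochschild.

(* Main.v *)
Require Import Defs.
From mathcomp Require Import all_boot all_order all_algebra finmap zify.
Import GRing.Theory.
Local Open Scope ring_scope.
Set Implicit Arguments.
Unset Strict Implicit.
Unset Printing Implicit Defensive.

(** Words are lists of homogeneous letters, and each letter has its degree
    lowered by one as weight.  With these weights, up to signs, [f \cup g] is
    the brace [mu{f, g}], the sum over all cuts of a word of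
    the values [mu (x1 f(x2) x3 g(x4) x5)], and [beta f] is the commutator of
    [f] and [mu].
    The Leibniz rule is then the [A_oo]-relation evaluated on the words
    [x1 f(x2) x3 g(x4) x5] and summed over all ways to cut a given word in five
    ([mu_ext_ainf_FG]).

    In that relation the inner [mu] may contain neither of the letters [f(x2)]
    and [g(x4)], one of them, or both.  Inserting [mu] into a word to which
    [f \cup g] is applied gives the terms with neither, and also the terms with
    [mu] inside [f] or inside [g] ([cut3_cut5]).  Applying [mu] to a word with
    an inserted [f \cup g] gives the terms with both.  The products
    [beta f \cup g] and [f \cup beta g] give the same terms with [mu] inside
    [f] or inside [g], and the terms with one of the two letters inside [mu]
    ([cup_word_beta_l], [cup_word_beta_r]).  So the difference of the two sides
    is a sum of six families of terms, all indexed by the cuts of the word in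
    seven, which vanishes ([beta_word_cup]).

    The combinatorics is that of deconcatenation: sums over cuts are
    coassociative ([cut2A]), and a cut of [x ++ c :: z] is a cut of [x] or of
    [z] ([cut2_letter]).  The signs are compared modulo 2 at the very end, term
    by term.  The codifferential and the cup product are multilinear extensions
    of formulas in homogeneous letters, which are rewritten as sums over cuts
    ([beta_linext], [cup_linext]); it suffices to compare them on homogeneous
    words.  The degree statement is a count of weights ([cup_CH]). *)

(** * Sums over the ways to cut a word *)

Section Cuts.
Variables (T : Type) (V : zmodType).
Implicit Types (t u v w x y z : seq T) (c : T).

(** Words are cut by recursion rather than by lengths: then no arithmetic on
    positions is needed to cut the parts again. *)
Fixpoint cut2 (G : seq T -> seq T -> V) t : V :=
  if t is c :: t' then G [::] t + cut2 (fun u v => G (c :: u) v) t'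
  else G [::] [::].

Definition cut3 H t : V := cut2 (fun x w => cut2 (H x) w) t.
Definition cut4 H t : V := cut2 (fun x w => cut3 (H x) w) t.
Definition cut5 H t : V := cut2 (fun x w => cut4 (H x) w) t.
Definition cut6 H t : V := cut2 (fun x w => cut5 (H x) w) t.
Definition cut7 H t : V := cut2 (fun x w => cut6 (H x) w) t.

Lemma eq_cut2_in G1 G2 t :
  (forall u v, t = u ++ v -> G1 u v = G2 u v) -> cut2 G1 t = cut2 G2 t.
Proof.
elim: t G1 G2 => [|c t IHt] G1 G2 eqG /=; first exact: eqG.
rewrite eqG // (IHt _ (fun u v => G2 (c :: u) v)) // => u v eq_t.
by apply: eqG; rewrite eq_t.
Qed.

Lemma eq_cut2 G1 G2 t : (forall u v, G1 u v = G2 u v) -> cut2 G1 t = cut2 G2 t.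
Proof. by move=> eqG; apply: eq_cut2_in => u v _. Qed.

Lemma cut2D G1 G2 t :
  cut2 (fun u v => G1 u v + G2 u v) t = cut2 G1 t + cut2 G2 t.
Proof.
elim: t G1 G2 => [|c t IHt] G1 G2 //=.
by rewrite (IHt (fun u => G1 (c :: u)) (fun u => G2 (c :: u))) addrACA.
Qed.

Lemma cut2_ind (P : V -> Prop) G t :
    (forall a b, P a -> P b -> P (a + b)) ->
    (forall u v, t = u ++ v -> P (G u v)) ->
  P (cut2 G t).
Proof.
move=> PD; elim: t G => [|c t IHt] G PG /=; first exact: PG.
by apply: PD; [exact: PG | apply: IHt => u v eq_t; apply: PG; rewrite eq_t].
Qed.

Lemma cut3_ind (P : V -> Prop) H t :
    (forall a b, P a -> P b -> P (a + b)) ->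
    (forall x y z, t = x ++ y ++ z -> P (H x y z)) ->
  P (cut3 H t).
Proof.
move=> PD PH; apply: cut2_ind => // x w eq_t.
by apply: cut2_ind => // y z eq_w; apply: PH; rewrite eq_t eq_w.
Qed.

Lemma cut5_ind (P : V -> Prop) H t :
    (forall a b, P a -> P b -> P (a + b)) ->
    (forall x1 x2 x3 x4 x5, t = x1 ++ x2 ++ x3 ++ x4 ++ x5 ->
       P (H x1 x2 x3 x4 x5)) ->
  P (cut5 H t).
Proof.
move=> PD PH; apply: cut2_ind => // x1 w eq_t.
apply: cut2_ind => // x2 w' eq_w; apply: cut3_ind => // x3 x4 x5 eq_w'.
by apply: PH; rewrite eq_t eq_w eq_w'.
Qed.

Lemma cut2_sum G t :
  cut2 G t = \sum_(0 <= i < (size t).+1) G (take i t) (drop i t).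
Proof.
elim: t G => [|c t IHt] G /=; first by rewrite big_nat1.
by rewrite big_nat_recl // IHt.
Qed.

(** Coassociativity of deconcatenation.  With the variants below for more
    parts, it brings every iterated cut to the form nested to the right. *)
Lemma cut2A H t :
  cut2 (fun x w => cut2 (fun u v => H u v w) x) t = cut3 H t.
Proof.
rewrite /cut3; elim: t H => [|c t IHt] H //=.
rewrite cut2D; rewrite [X in _ + (_ + X)](IHt (fun u v w => H (c :: u) v w)).
by rewrite addrA.
Qed.

Lemma cut23A H t :
  cut2 (fun x w => cut3 (fun a b d => H a b d w) x) t = cut4 H t.
Proof.
rewrite [LHS](cut2A (fun a b w => cut2 (fun b1 b2 => H a b1 b2 w) b)).
by apply: eq_cut2 => u v; exact: cut2A.
Qed.

Lemma cut24A H t :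
  cut2 (fun x w => cut4 (fun a b d e => H a b d e w) x) t = cut5 H t.
Proof.
rewrite [LHS](cut2A (fun a b w => cut3 (fun b1 b2 b3 => H a b1 b2 b3 w) b)).
by apply: eq_cut2 => u v; exact: cut23A.
Qed.

Lemma cut25A H t :
  cut2 (fun x w => cut5 (fun a b d e h => H a b d e h w) x) t = cut6 H t.
Proof.
rewrite [LHS](cut2A (fun a b w =>
  cut4 (fun b1 b2 b3 b4 => H a b1 b2 b3 b4 w) b)).
by apply: eq_cut2 => u v; exact: cut24A.
Qed.

(** A cut of [x ++ c :: z] is a cut of [x] or a cut of [z], according to the
    part that receives the letter [c]. *)
Lemma cut2_letter G x c z :
  cut2 G (x ++ c :: z) =
  cut2 (fun u v => G u (v ++ c :: z)) x + cut2 (fun u v => G (x ++ c :: u) v) z.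
Proof.
elim: x G => [|b x IHx] G //=.
by rewrite (IHx (fun u v => G (b :: u) v)) addrA.
Qed.

Lemma cut3_letter H x c z :
  cut3 H (x ++ c :: z) =
  cut3 (fun u v w => H u v (w ++ c :: z)) x
  + cut2 (fun u v => cut2 (fun v' w => H u (v ++ c :: v') w) z) x
  + cut3 (fun u v w => H (x ++ c :: u) v w) z.
Proof.
rewrite {1}/cut3 cut2_letter; congr (_ + _); rewrite -cut2D.
by apply: eq_cut2 => u v; rewrite cut2_letter.
Qed.

Lemma cut4_letter H x c z :
  cut4 H (x ++ c :: z) =
  cut4 (fun a1 a2 a3 a4 => H a1 a2 a3 (a4 ++ c :: z)) x
  + cut3 (fun a1 a2 a3 => cut2 (fun b a4 => H a1 a2 (a3 ++ c :: b) a4) z) x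
  + cut2 (fun a1 a2 => cut3 (fun b a3 a4 => H a1 (a2 ++ c :: b) a3 a4) z) x
  + cut4 (fun b a2 a3 a4 => H (x ++ c :: b) a2 a3 a4) z.
Proof.
rewrite {1}/cut4 cut2_letter; congr (_ + _); rewrite -!cut2D.
by apply: eq_cut2 => u v; rewrite cut3_letter.
Qed.

Lemma cut5_letter H x c z :
  cut5 H (x ++ c :: z) =
  cut5 (fun a1 a2 a3 a4 a5 => H a1 a2 a3 a4 (a5 ++ c :: z)) x
  + cut4 (fun a1 a2 a3 a4 =>
      cut2 (fun b a5 => H a1 a2 a3 (a4 ++ c :: b) a5) z) x
  + cut3 (fun a1 a2 a3 =>
      cut3 (fun b a4 a5 => H a1 a2 (a3 ++ c :: b) a4 a5) z) x
  + cut2 (fun a1 a2 =>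
      cut4 (fun b a3 a4 a5 => H a1 (a2 ++ c :: b) a3 a4 a5) z) x
  + cut5 (fun b a2 a3 a4 a5 => H (x ++ c :: b) a2 a3 a4 a5) z.
Proof.
rewrite {1}/cut5 cut2_letter; congr (_ + _); rewrite -!cut2D.
by apply: eq_cut2 => u v; rewrite cut4_letter.
Qed.

End Cuts.

(** Additive maps commute with sums over cuts; this serves for scalars and for
    the insertion of a sum into an argument of a multilinear map. *)
Section CutMorphism.
Variables (T : Type) (V W : zmodType) (h : V -> W).
Hypothesis hD : {morph h : x y / x + y}.

Lemma cut2_morph (G : seq T -> _ -> V) t :
  h (cut2 G t) = cut2 (fun u v => h (G u v)) t.
Proof. by elim: t G => [|c t IHt] G //=; rewrite hD IHt. Qed.

Lemma cut3_morph (G : seq T -> _ -> _ -> V) t :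
  h (cut3 G t) = cut3 (fun u v w => h (G u v w)) t.
Proof. by rewrite cut2_morph; apply: eq_cut2 => u v; exact: cut2_morph. Qed.

Lemma cut5_morph (G : seq T -> _ -> _ -> _ -> _ -> V) t :
  h (cut5 G t) = cut5 (fun a1 a2 a3 a4 a5 => h (G a1 a2 a3 a4 a5)) t.
Proof.
rewrite cut2_morph; apply: eq_cut2 => u v; rewrite cut2_morph.
by apply: eq_cut2 => *; exact: cut3_morph.
Qed.

Lemma cut7_morph (G : seq T -> _ -> _ -> _ -> _ -> _ -> _ -> V) t :
  h (cut7 G t) =
  cut7 (fun x1 x2 x3 x4 x5 x6 x7 => h (G x1 x2 x3 x4 x5 x6 x7)) t.
Proof.
rewrite cut2_morph; apply: eq_cut2 => u v; rewrite cut2_morph.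
by apply: eq_cut2 => *; exact: cut5_morph.
Qed.

End CutMorphism.

(** * Parities and signs *)

Lemma odd_abszD (a b : int) :
  odd `|(a + b)%R|%N = odd `|a|%N (+) odd `|b|%N.
Proof. lia. Qed.

Lemma odd_abszM (a b : int) : odd `|(a * b)%R|%N = odd `|a|%N && odd `|b|%N.
Proof. by rewrite abszM oddM. Qed.

Lemma odd_absz1 : odd `|1%R : int|%N = true. Proof. by []. Qed.
Lemma odd_abszN (a : int) : odd `|(- a)%R|%N = odd `|a|%N.
Proof. by rewrite abszN. Qed.
Definition odd_abszE := (odd_absz1, odd_abszN, odd_abszD, odd_abszM).

Section Signs.
Variable R : comPzRingType.
Implicit Types a b : int.

Lemma sgnz_parity a b : odd `|a|%N = odd `|b|%N -> sgnz R a = sgnz R b.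
Proof. by move=> eq_ab; rewrite /sgnz -signr_odd eq_ab signr_odd. Qed.

Lemma sgnzD a b : sgnz R (a + b) = sgnz R a * sgnz R b.
Proof.
by rewrite /sgnz -signr_odd odd_abszD signr_addb !signr_odd.
Qed.

Lemma sgnzS a : sgnz R (a + 1) = - sgnz R a.
Proof. by rewrite sgnzD mulrN1. Qed.
End Signs.

(** * Regrouping the cuts of cut words *)

Section Regroup.
Variables (T : Type) (V : zmodType).
Implicit Types (t u v w x y z : seq T).

Lemma eq_cut3_in H1 H2 t :
    (forall x y z, t = x ++ y ++ z -> H1 x y z = H2 x y z) ->
  cut3 H1 t = cut3 H2 t :> V.
Proof.
move=> eqH; apply: eq_cut2_in => x w eq_t.
by apply: eq_cut2_in => y z eq_w; apply: eqH; rewrite eq_t eq_w.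
Qed.

Lemma eq_cut4_in H1 H2 t :
    (forall x1 x2 x3 x4, t = x1 ++ x2 ++ x3 ++ x4 ->
       H1 x1 x2 x3 x4 = H2 x1 x2 x3 x4) ->
  cut4 H1 t = cut4 H2 t :> V.
Proof.
move=> eqH; apply: eq_cut2_in => x w eq_t.
by apply: eq_cut3_in => * ; apply: eqH; rewrite eq_t; congr (_ ++ _).
Qed.

Lemma eq_cut5_in H1 H2 t :
    (forall x1 x2 x3 x4 x5, t = x1 ++ x2 ++ x3 ++ x4 ++ x5 ->
       H1 x1 x2 x3 x4 x5 = H2 x1 x2 x3 x4 x5) ->
  cut5 H1 t = cut5 H2 t :> V.
Proof.
move=> eqH; apply: eq_cut2_in => x w eq_t.
by apply: eq_cut4_in => * ; apply: eqH; rewrite eq_t; congr (_ ++ _).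
Qed.

Lemma eq_cut7 H1 H2 t :
    (forall x1 x2 x3 x4 x5 x6 x7,
       H1 x1 x2 x3 x4 x5 x6 x7 = H2 x1 x2 x3 x4 x5 x6 x7) ->
  cut7 H1 t = cut7 H2 t :> V.
Proof.
by move=> eqH; do 2 apply: eq_cut2 => ? ?; apply: eq_cut5_in => *; apply: eqH.
Qed.

Lemma cut5D H1 H2 t :
  cut5 (fun x1 x2 x3 x4 x5 => H1 x1 x2 x3 x4 x5 + H2 x1 x2 x3 x4 x5) t =
  cut5 H1 t + cut5 H2 t :> V.
Proof.
rewrite /cut5 /cut4 /cut3 -cut2D.
by do 3 (apply: eq_cut2 => ? ?; rewrite -cut2D).
Qed.

Lemma cut2_exchange (H : _ -> _ -> _ -> _ -> V) t s :
  cut2 (fun u v => cut2 (fun x y => H u v x y) s) t =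
  cut2 (fun x y => cut2 (fun u v => H u v x y) t) s.
Proof.
elim: t H => [|c t IHt] H //=.
by rewrite cut2D (IHt (fun u => H (c :: u))).
Qed.

Lemma cut23_exchange (H : _ -> _ -> _ -> _ -> _ -> V) t s :
  cut2 (fun u v => cut3 (fun x y z => H u v x y z) s) t =
  cut3 (fun x y z => cut2 (fun u v => H u v x y z) t) s.
Proof.
by rewrite [LHS]cut2_exchange; apply: eq_cut2 => u v; exact: cut2_exchange.
Qed.

Lemma cut24_exchange (H : _ -> _ -> _ -> _ -> _ -> _ -> V) t s :
  cut2 (fun u v => cut4 (fun x1 x2 x3 x4 => H u v x1 x2 x3 x4) s) t =
  cut4 (fun x1 x2 x3 x4 => cut2 (fun u v => H u v x1 x2 x3 x4) t) s.
Proof.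
by rewrite [LHS]cut2_exchange; apply: eq_cut2 => u v; exact: cut23_exchange.
Qed.

Lemma cut25_exchange (H : _ -> _ -> _ -> _ -> _ -> _ -> _ -> V) t s :
  cut2 (fun u v => cut5 (fun x1 x2 x3 x4 x5 => H u v x1 x2 x3 x4 x5) s) t =
  cut5 (fun x1 x2 x3 x4 x5 => cut2 (fun u v => H u v x1 x2 x3 x4 x5) t) s.
Proof.
by rewrite [LHS]cut2_exchange; apply: eq_cut2 => u v; exact: cut24_exchange.
Qed.

(** Cutting one part of a cut further gives a finer cut.  In these refinements
    the part itself remains an argument of [H], and is replaced by the
    concatenation of its pieces: signs depend on the weight of the whole
    part. *)
Lemma cut3_refine2 (H : _ -> _ -> _ -> _ -> _ -> V) t :
  cut3 (fun x y z => cut2 (fun x1 x2 => H x x1 x2 y z) x) t =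
  cut4 (fun x1 x2 y z => H (x1 ++ x2) x1 x2 y z) t.
Proof.
transitivity (cut2 (fun x w => cut2 (fun x1 x2 =>
    cut2 (H (x1 ++ x2) x1 x2) w) x) t); last exact: cut2A.
apply: eq_cut2 => x w; rewrite [LHS]cut2_exchange.
by apply: eq_cut2_in => x1 x2 ->.
Qed.

Lemma cut3_refine3 (H : _ -> _ -> _ -> _ -> _ -> _ -> V) t :
  cut3 (fun x y z => cut3 (fun x1 x2 x3 => H x x1 x2 x3 y z) x) t =
  cut5 (fun x1 x2 x3 y z => H (x1 ++ x2 ++ x3) x1 x2 x3 y z) t.
Proof.
transitivity (cut2 (fun x w => cut3 (fun x1 x2 x3 =>
    cut2 (H (x1 ++ x2 ++ x3) x1 x2 x3) w) x) t); last exact: cut23A.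
apply: eq_cut2 => x w; rewrite [LHS]cut23_exchange.
by apply: eq_cut3_in => x1 x2 x3 ->.
Qed.

Lemma cut3_refine4 (H : _ -> _ -> _ -> _ -> _ -> _ -> _ -> V) t :
  cut3 (fun x y z => cut4 (fun x1 x2 x3 x4 => H x x1 x2 x3 x4 y z) x) t =
  cut6 (fun x1 x2 x3 x4 y z => H (x1 ++ x2 ++ x3 ++ x4) x1 x2 x3 x4 y z) t.
Proof.
transitivity (cut2 (fun x w => cut4 (fun x1 x2 x3 x4 =>
    cut2 (H (x1 ++ x2 ++ x3 ++ x4) x1 x2 x3 x4) w) x) t); last exact: cut24A.
apply: eq_cut2 => x w; rewrite [LHS]cut24_exchange.
by apply: eq_cut4_in => x1 x2 x3 x4 ->.
Qed.

Lemma cut3_refine5 (H : _ -> _ -> _ -> _ -> _ -> _ -> _ -> _ -> V) t :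
  cut3 (fun x y z => cut5 (fun x1 x2 x3 x4 x5 => H x x1 x2 x3 x4 x5 y z) x) t =
  cut7 (fun x1 x2 x3 x4 x5 y z =>
    H (x1 ++ x2 ++ x3 ++ x4 ++ x5) x1 x2 x3 x4 x5 y z) t.
Proof.
transitivity (cut2 (fun x w => cut5 (fun x1 x2 x3 x4 x5 =>
    cut2 (H (x1 ++ x2 ++ x3 ++ x4 ++ x5) x1 x2 x3 x4 x5) w) x) t);
  last exact: cut25A.
apply: eq_cut2 => x w; rewrite [LHS]cut25_exchange.
by apply: eq_cut5_in => x1 x2 x3 x4 x5 ->.
Qed.

(** The five sums are indexed by the part of the 5-cut that receives the new
    letter.  The first argument of [H] stands for data, such as signs, that
    depend on the word [x] as a whole. *)
Lemma cut3_cut5 (C : seq T -> T) (H : _ -> _ -> _ -> _ -> _ -> _ -> V) t :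
  cut3 (fun x y z => cut5 (H x) (x ++ C y :: z)) t =
    cut7 (fun x1 x2 x3 x4 x5 x6 x7 =>
      H x1 (x1 ++ C x2 :: x3) x4 x5 x6 x7) t
  + cut7 (fun x1 x2 x3 x4 x5 x6 x7 =>
      H (x1 ++ x2) x1 (x2 ++ C x3 :: x4) x5 x6 x7) t
  + cut7 (fun x1 x2 x3 x4 x5 x6 x7 =>
      H (x1 ++ x2 ++ x3) x1 x2 (x3 ++ C x4 :: x5) x6 x7) t
  + cut7 (fun x1 x2 x3 x4 x5 x6 x7 =>
      H (x1 ++ x2 ++ x3 ++ x4) x1 x2 x3 (x4 ++ C x5 :: x6) x7) t
  + cut7 (fun x1 x2 x3 x4 x5 x6 x7 =>
      H (x1 ++ x2 ++ x3 ++ x4 ++ x5) x1 x2 x3 x4 (x5 ++ C x6 :: x7)) t.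
Proof.
transitivity (
    cut3 (fun x y z => cut5 (fun b a2 a3 a4 a5 =>
      H x (x ++ C y :: b) a2 a3 a4 a5) z) t
  + cut3 (fun x y z => cut2 (fun a1 a2 =>
      cut4 (fun b a3 a4 a5 => H x a1 (a2 ++ C y :: b) a3 a4 a5) z) x) t
  + cut3 (fun x y z => cut3 (fun a1 a2 a3 =>
      cut3 (fun b a4 a5 => H x a1 a2 (a3 ++ C y :: b) a4 a5) z) x) t
  + cut3 (fun x y z => cut4 (fun a1 a2 a3 a4 =>
      cut2 (fun b a5 => H x a1 a2 a3 (a4 ++ C y :: b) a5) z) x) t
  + cut3 (fun x y z => cut5 (fun a1 a2 a3 a4 a5 =>
      H x a1 a2 a3 a4 (a5 ++ C y :: z)) x) t).
  rewrite -!cut2D; apply: eq_cut2 => x w; rewrite -!cut2D.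
  by apply: eq_cut2 => y z; rewrite cut5_letter [LHS](ACl (5*4*3*2*1)).
congr (_ + _ + _ + _ + _).
- exact: (cut3_refine2 (fun x x1 x2 y z => _)).
- exact: (cut3_refine3 (fun x x1 x2 x3 y z => _)).
- exact: (cut3_refine4 (fun x x1 x2 x3 x4 y z => _)).
- exact: (cut3_refine5 (fun x x1 x2 x3 x4 x5 y z => _)).
Qed.

Lemma cut3_cut5_mid (H : _ -> _ -> _ -> _ -> _ -> _ -> _ -> V) t :
  cut3 (fun x y z => cut5 (fun y1 y2 y3 y4 y5 => H x y1 y2 y3 y4 y5 z) y) t =
  cut7 H t.
Proof. by apply: eq_cut2 => x w; exact: cut25A. Qed.

Lemma cut33_exchange (H : _ -> _ -> _ -> _ -> _ -> _ -> V) t s :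
  cut3 (fun u v w => cut3 (fun x1 x2 x3 => H u v w x1 x2 x3) s) t =
  cut3 (fun x1 x2 x3 => cut3 (fun u v w => H u v w x1 x2 x3) t) s.
Proof.
rewrite -[RHS]cut23_exchange; apply: eq_cut2 => u v.
exact: cut23_exchange.
Qed.

Lemma cut34_exchange (H : _ -> _ -> _ -> _ -> _ -> _ -> _ -> V) t s :
  cut3 (fun u v w => cut4 (fun x1 x2 x3 x4 => H u v w x1 x2 x3 x4) s) t =
  cut4 (fun x1 x2 x3 x4 => cut3 (fun u v w => H u v w x1 x2 x3 x4) t) s.
Proof.
rewrite -[RHS]cut24_exchange; apply: eq_cut2 => u v.
exact: cut24_exchange.
Qed.

Lemma cut5_refine2_1st (H : _ -> _ -> _ -> _ -> _ -> _ -> _ -> V) t :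
  cut5 (fun x1 x2 x3 x4 x5 =>
    cut2 (fun y1 y2 => H x1 y1 y2 x2 x3 x4 x5) x1) t =
  cut6 (fun y1 y2 x2 x3 x4 x5 =>
    H (y1 ++ y2) y1 y2 x2 x3 x4 x5) t.
Proof.
transitivity (cut2 (fun x w => cut2 (fun y1 y2 =>
    cut4 (H (y1 ++ y2) y1 y2) w) x) t); last exact: cut2A.
apply: eq_cut2 => x w; rewrite -[LHS]cut24_exchange.
by apply: eq_cut2_in => y1 y2 ->.
Qed.

Lemma cut5_refine3_1st (H : _ -> _ -> _ -> _ -> _ -> _ -> _ -> _ -> V) t :
  cut5 (fun x1 x2 x3 x4 x5 =>
    cut3 (fun y1 y2 y3 => H x1 y1 y2 y3 x2 x3 x4 x5) x1) t =
  cut7 (fun y1 y2 y3 x2 x3 x4 x5 =>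
    H (y1 ++ y2 ++ y3) y1 y2 y3 x2 x3 x4 x5) t.
Proof.
transitivity (cut2 (fun x w => cut3 (fun y1 y2 y3 =>
    cut4 (H (y1 ++ y2 ++ y3) y1 y2 y3) w) x) t); last exact: cut23A.
apply: eq_cut2 => x w; rewrite -[LHS]cut34_exchange.
by apply: eq_cut3_in => y1 y2 y3 ->.
Qed.

Lemma cut5_refine3_2nd (H : _ -> _ -> _ -> _ -> _ -> _ -> _ -> _ -> V) t :
  cut5 (fun x1 x2 x3 x4 x5 =>
    cut3 (fun y1 y2 y3 => H x1 x2 y1 y2 y3 x3 x4 x5) x2) t =
  cut7 (fun x1 y1 y2 y3 x3 x4 x5 =>
    H x1 (y1 ++ y2 ++ y3) y1 y2 y3 x3 x4 x5) t.
Proof.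
apply: eq_cut2 => x1 w.
transitivity (cut2 (fun x w => cut3 (fun y1 y2 y3 =>
    cut3 (H x1 (y1 ++ y2 ++ y3) y1 y2 y3) w) x) w); last exact: cut23A.
apply: eq_cut2 => x w'; rewrite -[LHS]cut33_exchange.
by apply: eq_cut3_in => y1 y2 y3 ->.
Qed.

Lemma cut5_refine3_4th (H : _ -> _ -> _ -> _ -> _ -> _ -> _ -> _ -> V) t :
  cut5 (fun x1 x2 x3 x4 x5 =>
    cut3 (fun y1 y2 y3 => H x1 x2 x3 x4 y1 y2 y3 x5) x4) t =
  cut7 (fun x1 x2 x3 y1 y2 y3 x5 =>
    H x1 x2 x3 (y1 ++ y2 ++ y3) y1 y2 y3 x5) t.
Proof.
apply: eq_cut2 => x1 w1; apply: eq_cut2 => x2 w2; apply: eq_cut2 => x3 w3.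
transitivity (cut2 (fun x w => cut3 (fun y1 y2 y3 =>
    H x1 x2 x3 (y1 ++ y2 ++ y3) y1 y2 y3 w) x) w3); last exact: cut23A.
by apply: eq_cut2 => x w; apply: eq_cut3_in => y1 y2 y3 ->.
Qed.

(** The six sums are indexed by the parts of the 3-cut that receive the
    letters [C2 x2] and [C4 x4]. *)
Lemma cut5_cut3 (C2 C4 : seq T -> T)
    (H : _ -> _ -> _ -> _ -> _ -> _ -> V) t :
  cut5 (fun x1 x2 x3 x4 x5 =>
    cut3 (H x1 x2 x3) (x1 ++ C2 x2 :: x3 ++ C4 x4 :: x5)) t =
    cut7 (fun x1 x2 x3 x4 x5 x6 x7 =>
      H (x1 ++ x2 ++ x3) x4 x5 x1 x2 (x3 ++ C2 x4 :: x5 ++ C4 x6 :: x7)) t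
  + cut7 (fun x1 x2 x3 x4 x5 x6 x7 =>
      H (x1 ++ x2) x3 (x4 ++ x5) x1 (x2 ++ C2 x3 :: x4) (x5 ++ C4 x6 :: x7)) t
  + cut7 (fun x1 x2 x3 x4 x5 x6 x7 =>
      H (x1 ++ x2) x3 x4 x1 (x2 ++ C2 x3 :: x4 ++ C4 x5 :: x6) x7) t
  + cut7 (fun x1 x2 x3 x4 x5 x6 x7 =>
      H x1 x2 (x3 ++ x4 ++ x5) (x1 ++ C2 x2 :: x3) x4 (x5 ++ C4 x6 :: x7)) t
  + cut7 (fun x1 x2 x3 x4 x5 x6 x7 =>
      H x1 x2 (x3 ++ x4) (x1 ++ C2 x2 :: x3) (x4 ++ C4 x5 :: x6) x7) t
  + cut7 (fun x1 x2 x3 x4 x5 x6 x7 =>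
      H x1 x2 x3 (x1 ++ C2 x2 :: x3 ++ C4 x4 :: x5) x6 x7) t.
Proof.
transitivity (
    cut5 (fun x1 x2 x3 x4 x5 => cut3 (fun u v w =>
      H x1 x2 x3 u v (w ++ C2 x2 :: x3 ++ C4 x4 :: x5)) x1) t
  + cut5 (fun x1 x2 x3 x4 x5 => cut2 (fun u v => cut2 (fun v' w =>
      H x1 x2 x3 u (v ++ C2 x2 :: v') (w ++ C4 x4 :: x5)) x3) x1) t
  + cut5 (fun x1 x2 x3 x4 x5 => cut2 (fun u v => cut2 (fun v' w =>
      H x1 x2 x3 u (v ++ C2 x2 :: x3 ++ C4 x4 :: v') w) x5) x1) t
  + cut5 (fun x1 x2 x3 x4 x5 => cut3 (fun u v w =>
      H x1 x2 x3 (x1 ++ C2 x2 :: u) v (w ++ C4 x4 :: x5)) x3) t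
  + cut5 (fun x1 x2 x3 x4 x5 => cut2 (fun u v => cut2 (fun v' w =>
      H x1 x2 x3 (x1 ++ C2 x2 :: u) (v ++ C4 x4 :: v') w) x5) x3) t
  + cut5 (fun x1 x2 x3 x4 x5 => cut3 (fun u v w =>
      H x1 x2 x3 (x1 ++ C2 x2 :: x3 ++ C4 x4 :: u) v w) x5) t).
  rewrite -!cut5D; apply: eq_cut5_in => x1 x2 x3 x4 x5 _.
  rewrite cut3_letter cut3_letter !addrA; congr (_ + _ + _ + _).
  rewrite -[RHS]addrA; congr (_ + _); rewrite -cut2D; apply: eq_cut2 => u v.
  exact: cut2_letter.
congr (_ + _ + _ + _ + _ + _).
- exact: (cut5_refine3_1st (fun x1 u v w x2 x3 x4 x5 => _)).
- transitivity (cut6 (fun u v x2 x3 x4 x5 => cut2 (fun v' w =>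
      H (u ++ v) x2 x3 u (v ++ C2 x2 :: v') (w ++ C4 x4 :: x5)) x3) t).
    exact: (cut5_refine2_1st (fun x1 u v x2 x3 x4 x5 => _)).
  do 3 apply: eq_cut2 => ? ?.
  exact: (cut3_refine2 (fun x3 v' w x4 x5 => _)).
- exact: (cut5_refine2_1st (fun x1 u v x2 x3 x4 x5 => _)).
- do 2 apply: eq_cut2 => ? ?.
  exact: (cut3_refine3 (fun x3 u v w x4 x5 => _)).
- do 2 apply: eq_cut2 => ? ?.
  exact: (cut3_refine2 (fun x3 u v x4 x5 => _)).
Qed.
End Regroup.

(** * Words of homogeneous letters *)

Section GradedWords.
Variables (R : comPzRingType) (A : gradedModule R).
Implicit Types (t u v w : seq (int * A)) (f : seq A -> A).

(** The degree of a word in the bar construction, where letters are shifted by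
    one: the sign exponents are sums of weights of factors. *)
Definition wt t : int := \sum_(x <- t) (x.1 - 1).

Lemma wt_cat u v : wt (u ++ v) = wt u + wt v.
Proof. exact: big_cat. Qed.

Lemma wt_cons c v : wt (c :: v) = c.1 - 1 + wt v.
Proof. exact: big_cons. Qed.

Lemma wt_nil : wt [::] = 0.
Proof. exact: big_nil. Qed.

Definition wtE := (wt_cat, wt_cons, wt_nil).

Lemma wt_totdeg t : wt t = totdeg t - (size t)%:Z.
Proof.
elim: t => [|c t IHt]; first by rewrite wt_nil /totdeg big_nil subr0.
by rewrite wt_cons IHt /totdeg big_cons /=; lia.
Qed.

Lemma homogeneous_cat u v :
  homogeneous (u ++ v) = homogeneous u && homogeneous v.
Proof. exact: all_cat. Qed.

Lemma unzip2_cat u v : unzip2 (u ++ v) = unzip2 u ++ unzip2 v.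
Proof. exact: map_cat. Qed.

Lemma unzip2_cons (c : int * A) u : unzip2 (c :: u) = c.2 :: unzip2 u.
Proof. by []. Qed.

Lemma unzip2_take i u : unzip2 (take i u) = take i (unzip2 u).
Proof. exact: map_take. Qed.

Lemma unzip2_drop i u : unzip2 (drop i u) = drop i (unzip2 u).
Proof. exact: map_drop. Qed.

Lemma unzip2_slice i n u : unzip2 (slice i n u) = slice i n (unzip2 u).
Proof. by rewrite /slice unzip2_take unzip2_drop. Qed.

Definition unzip2E :=
  (unzip2_cat, unzip2_cons, unzip2_take, unzip2_drop, unzip2_slice).

(** The value of [f] on a word, as a letter: its degree is the one that the
    value has when [f] is of degree [p] as a Hochschild cochain. *)
Definition letter p f t : int * A :=
  (totdeg t + (p - (size t)%:Z), f (unzip2 t)).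

Lemma letter2E p f t : (letter p f t).2 = f (unzip2 t).
Proof. by []. Qed.

Lemma letter_wt p f t : (letter p f t).1 - 1 = wt t + (p - 1).
Proof. rewrite wt_totdeg /=; lia. Qed.

Lemma letter_hom p f t :
  CH p f -> homogeneous t -> (letter p f t).2 \in ghom A (letter p f t).1.
Proof. by move=> /(_ (size t))[_ hf] ht; apply: hf. Qed.

Definition kills0 f := forall a : seq A, 0 \in a -> f a = 0.

Lemma multilinear_kills0 f :
  (forall n, multilinear n f) -> kills0 f.
Proof.
move=> hf a /splitPr[s1 s2].
have := hf _ s1 s2 1 0 0 erefl.
by rewrite !scale1r addr0 -[LHS]addr0 => /addrI.
Qed.

Lemma CH_multilinear p f : CH p f -> forall n, multilinear n f.
Proof. by move=> hf n; have [] := hf n. Qed.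

Lemma CH_linear p f s1 s2 c x y : CH p f ->
  f (s1 ++ (c *: x + y) :: s2) = c *: f (s1 ++ x :: s2) + f (s1 ++ y :: s2).
Proof. by move=> /CH_multilinear hf; exact: (hf _ s1 s2). Qed.

(** [linext] replaces the arguments by their homogeneous components, so that
    formulas with equal values on homogeneous words have the same extension. *)
Lemma eq_linext_hom F G (a : seq A) :
  (forall t, homogeneous t -> size t = size a -> F t = G t) ->
  linext F a = linext G a.
Proof.
elim: a F G => [|x a IHa] F G eqFG /=; first exact: eqFG.
apply: eq_bigr => j _; apply: IHa => t ht size_t; apply: eqFG => /=.
  by rewrite gdec_hom.
by rewrite size_t.
Qed.

Lemma linext0 (F : seq (int * A) -> A) a :
  (forall t, F t = 0) -> linext F a = 0.
Proof.
elim: a F => [|x a IHa] F F0 /=; first exact: F0.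
by rewrite big1 // => j _; apply: IHa => t.
Qed.

Lemma linextD (F G : seq (int * A) -> A) a :
  linext (fun t => F t + G t) a = linext F a + linext G a.
Proof.
rewrite -[linext F a]scale1r -linext_linear.
by apply: eq_linext => t; rewrite scale1r.
Qed.

Lemma linext_sum (I : Type) (r : seq I) (F : I -> seq (int * A) -> A) a :
  \sum_(i <- r) linext (F i) a = linext (fun t => \sum_(i <- r) F i t) a.
Proof.
elim: r => [|i r IHr].
  by rewrite big_nil linext0 // => t; rewrite big_nil.
rewrite big_cons IHr -linextD.
by apply: eq_linext => t; rewrite big_cons.
Qed.

(** By uniqueness of the decomposition, compared with the sums of the components
    over the union of the two supports. *)
Lemma gdec_linear c (x y : A) j :
  gdec (c *: x + y) j = c *: gdec x j + gdec y j.
Proof.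
pose S := (finsupp (gdec x) `|` finsupp (gdec y))%fset.
pose b := [fsfun i in S => c *: gdec x i + gdec y i | 0]
  : {fsfun int -> A with 0}.
have widen (z : A) (S' : {fset int}) : (finsupp (gdec z) `<=` S')%fset ->
    \sum_(i <- S') gdec z i = z.
  move=> sS; rewrite -[RHS]gdec_sum; symmetry; apply: big_fset_incl => // i _.
  by rewrite memNfinsupp => /eqP.
have bE i : b i = c *: gdec x i + gdec y i.
  rewrite fsfunE; case: ifPn => // ; rewrite inE negb_or !memNfinsupp.
  by move=> /andP[/eqP-> /eqP->]; rewrite scaler0 addr0.
have sbS : (finsupp b `<=` S)%fset.
  apply/fsubsetP => i; rewrite mem_finsupp fsfunE; case: ifP => //.
  by rewrite eqxx.
have b_sum : \sum_(i <- finsupp b) b i = c *: x + y.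
  have -> : \sum_(i <- finsupp b) b i = \sum_(i <- S) b i.
    by apply: big_fset_incl => // i _; rewrite memNfinsupp => /eqP.
  under eq_bigr do rewrite bE.
  rewrite big_split -scaler_sumr !widen ?fsubsetUl ?fsubsetUr //.
rewrite -b_sum gdec_uniq ?bE // => i; rewrite bE.
by rewrite rpredD ?rpredZ ?gdec_hom.
Qed.

Definition letter_linear (F : seq (int * A) -> A) :=
  forall u v j (c : R) (x y : A),
    F (u ++ (j, c *: x + y) :: v) =
    c *: F (u ++ (j, x) :: v) + F (u ++ (j, y) :: v).

(** The supports of [gdec x], [gdec y] and [gdec (c *: x + y)] differ; as [F]
    vanishes on words with a letter of value 0, the three sums may be taken
    over the union of the supports. *)
Lemma linext_multilinear F n : letter_linear F -> multilinear n (linext F).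
Proof.
move=> linF s1 s2 c x y _.
elim: s1 F linF => [|z s1 IHs1] F linF /=; last first.
  rewrite scaler_sumr -big_split; apply: eq_bigr => j _.
  by apply: IHs1 => u v; exact: (linF (_ :: u)).
pose S := (finsupp (gdec (c *: x + y))
             `|` (finsupp (gdec x) `|` finsupp (gdec y)))%fset.
have F0 j v : F ((j, 0) :: v) = 0.
  have := linF [::] v j 1 0 0.
  by rewrite !scale1r addr0 -[LHS]addr0 => /addrI.
have widen (z : A) : (finsupp (gdec z) `<=` S)%fset ->
    \sum_(j <- finsupp (gdec z)) linext (fun t => F ((j, gdec z j) :: t)) s2 =
    \sum_(j <- S) linext (fun t => F ((j, gdec z j) :: t)) s2.
  move=> sS; apply: big_fset_incl => // j _; rewrite memNfinsupp => /eqP->.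
  by rewrite linext0.
have [sS1 sS2 sS3] : [/\ finsupp (gdec (c *: x + y)) `<=` S,
    finsupp (gdec x) `<=` S & finsupp (gdec y) `<=` S]%fset.
  split; first exact: fsubsetUl.
    by apply: fsubset_trans (fsubsetUr _ _); exact: fsubsetUl.
  by apply: fsubset_trans (fsubsetUr _ _); exact: fsubsetUr.
rewrite !widen //.
rewrite scaler_sumr -big_split; apply: eq_bigr => j _ /=.
rewrite -linext_linear; apply: eq_linext => t.
by rewrite gdec_linear; exact: (linF [::]).
Qed.

End GradedWords.

(** * The operations as sums over cuts *)

(** Permutes the sizes of the parts of a cut, which are indices with a bounded
    sum. *)
Lemma exchange_triangle (V : zmodType) N (G : nat -> nat -> V) :
  \sum_(0 <= i < N.+1) \sum_(0 <= j < (N - i).+1) G i j =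
  \sum_(0 <= j < N.+1) \sum_(0 <= i < (N - j).+1) G i j.
Proof.
have widen (F : nat -> nat -> V) :
    \sum_(0 <= i < N.+1) \sum_(0 <= j < (N - i).+1) F i j =
    \sum_(0 <= i < N.+1) \sum_(0 <= j < N.+1)
      if (i + j <= N)%N then F i j else 0.
  apply: eq_big_nat => i /andP[_ lt_iN].
  rewrite (big_nat_widen 0 _ N.+1) ?ltnS ?leq_subr // big_mkcond /=.
  by apply: eq_big_nat => j _; rewrite ltnS leq_subRL.
rewrite !widen exchange_big_nat; apply: eq_big_nat => j _.
by apply: eq_big_nat => i _; rewrite addnC.
Qed.

Section Operations.
Variables (R : comPzRingType) (A : ainfAlgebra R).
Implicit Types (p q : int) (f g : seq A -> A) (t u v w x y z : seq (int * A)).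

(** The family of all [mu_n], completed by [mu_0 = 0], is a Hochschild cochain
    of degree 2: inserting it into words may then be done at empty factors
    too. *)
Definition mu_ext (a : seq A) : A := if a is [::] then 0 else mu a.

Lemma mu_ext_cat_cons (s1 s2 : seq A) c :
  mu_ext (s1 ++ c :: s2) = mu (s1 ++ c :: s2).
Proof. by case: s1. Qed.

Lemma mu_ext_slice (a : seq A) i l : (i < size a)%N ->
  mu_ext (slice i l.+1 a) = mu (slice i l.+1 a).
Proof.
move=> lt_i; case eq_s: (slice i l.+1 a) => [|c s] //.
move/(congr1 size): eq_s; rewrite /slice size_take_min size_drop /=; lia.
Qed.

Lemma mu_ext_CH : CH 2 mu_ext.
Proof.
case=> [|n]; split.
- by move=> s1 s2 c x y.
- by move=> [|c t] // _ _; exact: rpred0.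
- move=> s1 s2 c x y eq_n; rewrite !mu_ext_cat_cons.
  by have [mu_lin _] := @mu_hom R A n.+1 isT; exact: mu_lin.
- move=> [//|c t] size_t ht.
  by have [_ mu_deg] := @mu_hom R A n.+1 isT; exact: mu_deg.
Qed.

Lemma mu_ext_kills0 : kills0 mu_ext.
Proof. by apply: multilinear_kills0; exact: CH_multilinear mu_ext_CH. Qed.

(** The codifferential on words of homogeneous letters, summed over the factor
    that is the argument of the inner operation instead of over arities and
    positions. *)
Definition beta_word p f t : A :=
  cut3 (fun x y z => sgnz R (wt x) *:
      f (unzip2 (x ++ letter 2 mu_ext y :: z))) t
  + cut3 (fun x y z => sgnz R ((p - 1) * (wt x + 1) + 1) *:
      mu_ext (unzip2 (x ++ letter p f y :: z))) t.

Definition cup_word p q f g t : A :=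
  cut5 (fun x1 x2 x3 x4 x5 =>
    sgnz R ((p - 1) * wt x1 + (q - 1) * (wt x1 + wt x2 + wt x3 + p)) *:
    mu_ext (unzip2 (x1 ++ letter p f x2 :: x3 ++ letter q g x4 :: x5))) t.

Lemma cut3_sum (V : zmodType) (H : _ -> _ -> seq (int * A) -> V) t :
  cut3 H t = \sum_(0 <= i < (size t).+1) \sum_(0 <= n < (size t - i).+1)
     H (take i t) (slice i n t) (drop (i + n) t).
Proof.
rewrite /cut3 cut2_sum; apply: eq_big_nat => i _.
rewrite cut2_sum size_drop; apply: eq_big_nat => n _.
by rewrite drop_drop addnC.
Qed.

(** In the first half, the arity [n] of [f] and the position determine the
    length of the factor given to [mu]; the extra cuts, at empty factors, have
    [mu_0 = 0] among the arguments of [f]. *)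
Lemma sum_beta_comp p f t : kills0 f ->
  \sum_(0 <= n < (size t).+1) beta_comp p n (size t - n) f t = beta_word p f t.
Proof.
move=> f0; rewrite /beta_comp big_split /beta_word; congr (_ + _); last first.
  rewrite cut3_sum exchange_triangle /=; apply: eq_big_nat => n _.
  apply: eq_big_nat => i _; rewrite !unzip2E mu_ext_cat_cons.
  by rewrite !letter2E !unzip2E.
rewrite cut3_sum exchange_triangle /= big_nat_recl // big_geq // add0r.
rewrite [RHS]big_nat_recl // [X in _ = X + _]big1 ?add0r; last first.
  move=> i _; rewrite !unzip2E /slice take0 f0 ?scaler0 //.
  by rewrite mem_cat inE eqxx orbT.
rewrite big_nat_rev; apply: eq_big_nat => l /andP[_ lt_l]; rewrite add0n.
apply: eq_big_nat => i /andP[_ lt_i].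
rewrite (_ : size t - (size t - l.+1).+1 = l)%N; last by lia.
by rewrite !unzip2E letter2E unzip2E mu_ext_slice ?size_map //; lia.
Qed.

Lemma beta_linext p f a : kills0 f -> beta p f a = linext (beta_word p f) a.
Proof.
move=> f0; rewrite /beta linext_sum; apply: eq_linext_hom => t _ <-.
exact: sum_beta_comp.
Qed.

(** Both sides sum over the sizes of the first four parts of a 5-cut, in
    different orders. *)
Lemma sum_cup_comp p q f g t :
  \sum_(0 <= m < (size t).+1) \sum_(0 <= n < (size t - m).+1)
    cup_comp p q m n (size t - m - n) f g t = cup_word p q f g t.
Proof.
pose G m n i j := cup_term p q m n i (i + m + j) f g t.
transitivity (\sum_(0 <= m < (size t).+1) \sum_(0 <= n < (size t - m).+1)
  \sum_(0 <= i < (size t - m - n).+1) \sum_(0 <= j < (size t - m - n - i).+1)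
    G m n i j).
  apply: eq_big_nat => m _; apply: eq_big_nat => n _.
  apply: eq_big_nat => i /andP[_ lt_i].
  rewrite -{1}[(i + m)%N]add0n big_addn.
  rewrite (_ : _ - (i + m) = (size t - m - n - i).+1)%N; last by lia.
  by apply: eq_big_nat => j _; rewrite /G addnC.
rewrite /cup_word /cut5 cut2_sum.
transitivity (\sum_(0 <= m < (size t).+1) \sum_(0 <= i < (size t - m).+1)
  \sum_(0 <= j < (size t - m - i).+1) \sum_(0 <= n < (size t - m - i - j).+1)
    G m n i j).
  apply: eq_big_nat => m _; rewrite exchange_triangle; apply: eq_big_nat => i _.
  rewrite -exchange_triangle; apply: eq_big_nat => n _.
  by rewrite subnAC.
rewrite exchange_triangle; apply: eq_big_nat => i _.
rewrite /cut4 cut2_sum size_drop; apply: eq_big_nat => m _.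
rewrite /cut3 cut2_sum !size_drop subnAC; apply: eq_big_nat => j _.
rewrite cut2_sum !size_drop; apply: eq_big_nat => n _.
rewrite /G /cup_term !drop_drop /slice !unzip2E mu_ext_cat_cons.
rewrite !letter2E !unzip2E.
rewrite addKn -!wt_cat.
rewrite [(m + i)%N]addnC [(j + _)%N]addnC [(n + _)%N]addnC.
rewrite -[maltese t i]/(wt (take i t)) -[maltese t _]/(wt (take (i + m + j) t)).
by rewrite !takeD.
Qed.

Lemma cup_linext p q f g a : cup p q f g a = linext (cup_word p q f g) a.
Proof.
rewrite /cup.
under eq_bigr do rewrite linext_sum.
rewrite linext_sum; apply: eq_linext_hom => t _ <-.
exact: sum_cup_comp.
Qed.

(** Since [mu_0 = 0], the cuts at an empty middle factor only add zeros to the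
    defining relation. *)
Lemma mu_ext_ainf w : homogeneous w ->
  cut3 (fun x y z => sgnz R (wt x) *:
    mu_ext (unzip2 (x ++ letter 2 mu_ext y :: z))) w = 0.
Proof.
move=> hw; rewrite cut3_sum exchange_triangle big_nat_recl //.
rewrite big1 ?add0r => [|i _]; last first.
  rewrite !unzip2E /slice take0 mu_ext_kills0 ?scaler0 //.
  by rewrite mem_cat inE eqxx orbT.
have [-> | w_neq0] := posnP (size w); first by rewrite big_geq.
rewrite -[RHS](mu_ainf w_neq0 hw) big_add1 /=; apply: eq_big_nat => l lt_l.
rewrite subSS (_ : (size w - l.+1).+1 = (size w - l)%N); last by lia.
apply: eq_big_nat => i lt_i; rewrite !unzip2E mu_ext_cat_cons letter2E.
by rewrite unzip2E mu_ext_slice ?size_map //; lia.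
Qed.

End Operations.

Arguments mu_ext {R A} a.
Arguments mu_ext_CH {R A}.
Arguments mu_ext_kills0 {R A}.

(** * Evaluation on homogeneous words *)

Section Evaluation.
Variables (R : comPzRingType) (A : ainfAlgebra R).
Implicit Types (p q : int) (f g : seq A -> A) (t u v w x y z : seq (int * A)).

Lemma CH_kills0 p f : CH p f -> kills0 f.
Proof. by move=> /CH_multilinear; exact: multilinear_kills0. Qed.

Lemma beta_word_kills0 p f u : CH p f -> 0 \in unzip2 u -> beta_word p f u = 0.
Proof.
move=> hf u0; have f0 := CH_kills0 hf; have mu0 := @mu_ext_kills0 R A.
have D0 (a b : A) : a = 0 -> b = 0 -> a + b = 0 by move=> -> ->; rewrite addr0.
apply: (D0); apply: (cut3_ind (P := fun a => a = 0) D0) => x y z eq_u;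
  move: u0; rewrite eq_u !unzip2E !mem_cat => u0.
  rewrite f0 ?scaler0 // mem_cat inE letter2E.
  case/or3P: u0 => [-> //|y0|->]; last by rewrite !orbT.
  by rewrite mu0 // eqxx orbT.
rewrite mu0 ?scaler0 // mem_cat inE letter2E.
case/or3P: u0 => [-> //|y0|->]; last by rewrite !orbT.
by rewrite f0 // eqxx orbT.
Qed.

Lemma cup_word_kills0 p q f g u : CH p f -> CH q g ->
  0 \in unzip2 u -> cup_word p q f g u = 0.
Proof.
move=> hf hg u0; have f0 := CH_kills0 hf; have g0 := CH_kills0 hg.
apply: (cut5_ind (P := fun a => a = 0)) => [a b -> ->|]; first exact: addr0.
move=> x1 x2 x3 x4 x5 eq_u; move: u0; rewrite eq_u !unzip2E !mem_cat => u0.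
rewrite mu_ext_kills0 ?scaler0 // !(mem_cat, inE) !letter2E.
case/orP: u0 => [-> //|/orP[y0|]]; first by rewrite f0 // eqxx orbT.
case/or3P=> [->|y0|->]; rewrite ?orbT //.
by rewrite [g _]g0 // eqxx !orbT.
Qed.

Lemma beta_hom p f t : CH p f -> homogeneous t ->
  beta p f (unzip2 t) = beta_word p f t.
Proof.
move=> hf ht; rewrite beta_linext; last exact: CH_kills0 hf.
by apply: linextE => // u _; exact: beta_word_kills0.
Qed.

Lemma cup_hom p q f g t : CH p f -> CH q g -> homogeneous t ->
  cup p q f g (unzip2 t) = cup_word p q f g t.
Proof.
move=> hf hg ht; rewrite cup_linext.
by apply: linextE => // u _; exact: cup_word_kills0.
Qed.

(** * The degree of the cup product *)

Lemma cut2_comb (c : R) (G1 G2 : seq (int * A) -> seq (int * A) -> A) t :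
  cut2 (fun u v => c *: G1 u v + G2 u v) t = c *: cut2 G1 t + cut2 G2 t.
Proof. by rewrite cut2D -(cut2_morph (scalerDr c)). Qed.

(** The letter that varies lies in one of the two parts. *)
Lemma cut2_letter_linear G :
    (forall u, letter_linear (G u)) -> (forall v, letter_linear (G^~ v)) ->
  letter_linear (cut2 G).
Proof.
move=> linr linl u v j c x y; rewrite !cut2_letter scalerDr addrACA.
rewrite -!cut2_comb; congr (_ + _); apply: eq_cut2 => *.
  exact: linr.
exact: linl.
Qed.

Lemma cut2_param_linear (G : _ -> _ -> _ -> A) t :
    (forall u v, letter_linear (fun w => G w u v)) ->
  letter_linear (fun w => cut2 (G w) t).
Proof.
move=> linG u v j c x y; rewrite -cut2_comb.
by apply: eq_cut2 => *; apply: linG.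
Qed.

Lemma letter_linearZ (s : seq (int * A) -> R) F :
    (forall u v j (x y : A), s (u ++ (j, x) :: v) = s (u ++ (j, y) :: v)) ->
    letter_linear F ->
  letter_linear (fun w => s w *: F w).
Proof.
move=> eq_s linF u v j c x y; rewrite /= linF.
rewrite (eq_s _ _ _ (c *: x + y) x) (eq_s _ _ _ y x).
by rewrite scalerDr !scalerA mulrC.
Qed.

(** The varying letter lies in one of the five parts; the signs only depend on
    its degree, and the value is linear by multilinearity of [mu], composed with
    that of [f] or [g] in the second and fourth part. *)
Lemma cup_word_letter_linear p q f g : CH p f -> CH q g ->
  letter_linear (cup_word p q f g).
Proof.
move=> hf hg.
have wtE' u v j (x y : A) : wt (u ++ (j, x) :: v) = wt (u ++ (j, y) :: v).
  by rewrite !wtE.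
apply: cut2_letter_linear => [x1|w].
  apply: cut2_letter_linear => [x2|w].
    apply: cut2_letter_linear => [x3|w].
      apply: cut2_letter_linear => [x4|x5].
        apply: letter_linearZ => // u v j c x y.
        by rewrite !unzip2E -!cat_cons !catA (CH_linear _ _ _ _ _ mu_ext_CH).
      apply: letter_linearZ => // u v j c x y.
      rewrite !unzip2E !letter2E !unzip2E (CH_linear _ _ _ _ _ hg).
      by rewrite -!cat_cons !catA (CH_linear _ _ _ _ _ mu_ext_CH).
    apply: cut2_param_linear => x4 x5.
    apply: letter_linearZ => [u v j x y|u v j c x y].
      by rewrite (wtE' _ _ _ x y).
    have := CH_linear (rcons (unzip2 x1) (letter p f x2).2 ++ unzip2 u)
      (unzip2 v ++ unzip2 (letter q g x4 :: x5)) c x y mu_ext_CH.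
    by rewrite !unzip2E -!catA !cat_rcons.
  do 2 apply: cut2_param_linear => ? ?.
  apply: letter_linearZ => [u v j x y|u v j c x y].
    by rewrite (wtE' _ _ _ x y).
  rewrite !unzip2E !letter2E !unzip2E (CH_linear _ _ _ _ _ hf).
  by rewrite (CH_linear _ _ _ _ _ mu_ext_CH).
do 3 apply: cut2_param_linear => ? ?.
apply: letter_linearZ => [u v j x y|u v j c x y].
  by rewrite (wtE' _ _ _ x y).
by rewrite !unzip2E -!catA (CH_linear _ _ _ _ _ mu_ext_CH).
Qed.

(** In terms of weights, [f], [g] and [mu] raise the degree by [p - 1], [q - 1]
    and 1, hence each term of the cup product by [(p + q) - 1]. *)
Lemma cup_CH p q f g : CH p f -> CH q g -> CH (p + q) (cup p q f g).
Proof.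
move=> hf hg n; split.
  move=> s1 s2 c x y size_s; rewrite !cup_linext.
  by apply: linext_multilinear size_s; exact: cup_word_letter_linear.
move=> t size_t ht; rewrite cup_hom //.
apply: (cut5_ind (P := fun a => a \in ghom A _)) => [a b|].
  exact: rpredD.
move=> x1 x2 x3 x4 x5 eq_t; apply: rpredZ.
have: homogeneous (x1 ++ letter p f x2 :: x3 ++ letter q g x4 :: x5).
  move: ht; rewrite eq_t !homogeneous_cat /= !homogeneous_cat /=.
  by case/and5P=> -> hx2 -> hx4 ->; rewrite !letter_hom.
move/(letter_hom mu_ext_CH); rewrite letter2E.
set w := x1 ++ _.
suff -> : totdeg t + (p + q - n%:Z) = (letter 2 mu_ext w).1 by [].
apply: (addIr (-1)); rewrite letter_wt /w !wtE !letter_wt -size_t.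
have := wt_totdeg t; rewrite {1}eq_t !wtE; lia.
Qed.

End Evaluation.

(** * The Leibniz rule *)

Section Leibniz.
Variables (R : comPzRingType) (A : ainfAlgebra R) (p q : int).
Variables f g : seq A -> A.
Hypotheses (hf : CH p f) (hg : CH q g).
Implicit Types (t u v w x y z : seq (int * A)).

Notation M := (letter 2 mu_ext).
Notation F := (letter p f).
Notation G := (letter q g).
Notation m w := (mu_ext (unzip2 w)).

Lemma mu_ext_slotD (k : R) (s1 s2 : seq A) :
  {morph (fun c => k *: mu_ext (s1 ++ c :: s2)) : a b / a + b}.
Proof.
move=> a b; rewrite -scalerDr -[a]scale1r; congr (_ *: _).
by rewrite (CH_linear _ _ _ _ _ mu_ext_CH) !scale1r.
Qed.

Lemma mu_ext_slotZ (k : R) (s1 s2 : seq A) a :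
  mu_ext (s1 ++ k *: a :: s2) = k *: mu_ext (s1 ++ a :: s2).
Proof.
rewrite -[k *: a]addr0 (CH_linear _ _ _ _ _ mu_ext_CH).
by rewrite [mu_ext (_ ++ 0 :: _)]mu_ext_kills0 ?addr0 // mem_cat inE eqxx orbT.
Qed.

(** The sign with which the [A_oo]-relation of the word [x F(y) z G(_) _]
    enters the Leibniz rule. *)
Definition rel_sign x y z : R :=
  sgnz R ((p - 1) * (wt x + 1) + (q - 1) * (wt x + wt y + wt z + 1 + p)).

(** The [A_oo]-relation of the words [x1 F(x2) x3 G(x4) x5], summed over all
    5-cuts of [t].  The six sums are indexed by the position of the inner [mu]
    with respect to [F] and [G]. *)
Lemma mu_ext_ainf_FG t : homogeneous t ->
    cut7 (fun x1 x2 x3 x4 x5 x6 x7 => rel_sign (x1 ++ x2 ++ x3) x4 x5 *: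
      (sgnz R (wt x1) *: m (x1 ++ M x2 :: x3 ++ F x4 :: x5 ++ G x6 :: x7))) t
  + cut7 (fun x1 x2 x3 x4 x5 x6 x7 => rel_sign (x1 ++ x2) x3 (x4 ++ x5) *:
      (sgnz R (wt x1) *: m (x1 ++ M (x2 ++ F x3 :: x4) :: x5 ++ G x6 :: x7))) t
  + cut7 (fun x1 x2 x3 x4 x5 x6 x7 => rel_sign (x1 ++ x2) x3 x4 *:
      (sgnz R (wt x1) *: m (x1 ++ M (x2 ++ F x3 :: x4 ++ G x5 :: x6) :: x7))) t
  + cut7 (fun x1 x2 x3 x4 x5 x6 x7 => rel_sign x1 x2 (x3 ++ x4 ++ x5) *:
      (sgnz R (wt (x1 ++ F x2 :: x3)) *:
        m ((x1 ++ F x2 :: x3) ++ M x4 :: x5 ++ G x6 :: x7))) t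
  + cut7 (fun x1 x2 x3 x4 x5 x6 x7 => rel_sign x1 x2 (x3 ++ x4) *:
      (sgnz R (wt (x1 ++ F x2 :: x3)) *:
        m ((x1 ++ F x2 :: x3) ++ M (x4 ++ G x5 :: x6) :: x7))) t
  + cut7 (fun x1 x2 x3 x4 x5 x6 x7 => rel_sign x1 x2 x3 *:
      (sgnz R (wt (x1 ++ F x2 :: x3 ++ G x4 :: x5)) *:
        m ((x1 ++ F x2 :: x3 ++ G x4 :: x5) ++ M x6 :: x7))) t
  = 0.
Proof.
move=> ht; rewrite -(cut5_cut3 F G (fun x1 x2 x3 x y z => rel_sign x1 x2 x3 *:
  (sgnz R (wt x) *: m (x ++ M y :: z)))).
apply: (cut5_ind (P := fun a => a = 0)) => [a b -> ->|]; first exact: addr0.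
move=> x1 x2 x3 x4 x5 eq_t.
rewrite -(cut3_morph (scalerDr (rel_sign x1 x2 x3))) mu_ext_ainf ?scaler0 //.
move: ht; rewrite eq_t !homogeneous_cat /= !homogeneous_cat /=.
by case/and5P=> -> hx2 -> hx4 ->; rewrite !letter_hom.
Qed.

(** Compares two terms with equal values: the parities of the sign exponents
    are boolean polynomials in the parities of [p], [q] and of the weights of
    the factors, which are compared by enumeration. *)
Ltac koszul :=
  rewrite !(unzip2E, letter2E) ?mu_ext_slotZ -?catA ?cat_cons -?catA;
  rewrite -?scaleNr ?scalerA;
  rewrite -?sgnzS -?sgnzD;
  congr (_ *: _); apply: sgnz_parity;
  rewrite !(wtE, letter_wt) !odd_abszE;
  repeat match goal with |- context [odd ?n] => generalize (odd n) end;
  repeat case; reflexivity.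

(** The two sums come from the two halves of the codifferential of [f]: [mu]
    inside [f], and [f] inside [mu]. *)
Lemma cup_word_beta_l t : homogeneous t ->
  cup_word (p + 1) q (beta p f) g t =
    cut7 (fun x1 x2 x3 x4 x5 x6 x7 =>
      sgnz R (wt (x1 ++ x2)) *: (sgnz R ((p - 1) * wt x1 +
        (q - 1) * (wt x1 + wt (x2 ++ M x3 :: x4) + wt x5 + p)) *:
      m (x1 ++ F (x2 ++ M x3 :: x4) :: x5 ++ G x6 :: x7))) t
  - cut7 (fun x1 x2 x3 x4 x5 x6 x7 => rel_sign (x1 ++ x2) x3 (x4 ++ x5) *:
      (sgnz R (wt x1) *: m (x1 ++ M (x2 ++ F x3 :: x4) :: x5 ++ G x6 :: x7))) t.
Proof.
move=> ht.
pose e x1 x2 x3 :=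
  sgnz R ((p + 1 - 1) * wt x1 + (q - 1) * (wt x1 + wt x2 + wt x3 + (p + 1))).
transitivity (
    cut5 (fun x1 x2 x3 x4 x5 => cut3 (fun y1 y2 y3 => e x1 x2 x3 *:
      mu_ext (unzip2 x1 ++ sgnz R (wt y1) *: f (unzip2 (y1 ++ M y2 :: y3)) ::
           unzip2 (x3 ++ G x4 :: x5))) x2) t
  + cut5 (fun x1 x2 x3 x4 x5 => cut3 (fun y1 y2 y3 => e x1 x2 x3 *:
      mu_ext (unzip2 x1 ++ sgnz R ((p - 1) * (wt y1 + 1) + 1) *:
             mu_ext (unzip2 (y1 ++ F y2 :: y3)) ::
           unzip2 (x3 ++ G x4 :: x5))) x2) t).
  rewrite -cut5D; apply: eq_cut5_in => x1 x2 x3 x4 x5 eq_t.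
  have hx2 : homogeneous x2.
    by move: ht; rewrite eq_t !homogeneous_cat => /and3P[].
  rewrite -!(cut3_morph (mu_ext_slotD _ _ _)) -mu_ext_slotD.
  rewrite -/(beta_word p f x2).
  by rewrite -(beta_hom hf hx2) unzip2_cat unzip2_cons.
rewrite (cut5_refine3_2nd (fun x1 x2 y1 y2 y3 x3 x4 x5 => _)).
rewrite (cut5_refine3_2nd (fun x1 x2 y1 y2 y3 x3 x4 x5 => _)).
rewrite (cut7_morph (@opprD A)).
congr (_ + _); apply: eq_cut7 => x1 x2 x3 x4 x5 x6 x7; rewrite /e /rel_sign.
  by koszul.
by koszul.
Qed.

Lemma cup_word_beta_r t : homogeneous t ->
  sgnz R p *: cup_word p (q + 1) f (beta q g) t =
    cut7 (fun x1 x2 x3 x4 x5 x6 x7 =>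
      sgnz R (wt (x1 ++ x2 ++ x3 ++ x4)) *: (sgnz R ((p - 1) * wt x1 +
        (q - 1) * (wt x1 + wt x2 + wt x3 + p)) *:
      m (x1 ++ F x2 :: x3 ++ G (x4 ++ M x5 :: x6) :: x7))) t
  - cut7 (fun x1 x2 x3 x4 x5 x6 x7 => rel_sign x1 x2 (x3 ++ x4) *:
      (sgnz R (wt (x1 ++ F x2 :: x3)) *:
        m ((x1 ++ F x2 :: x3) ++ M (x4 ++ G x5 :: x6) :: x7))) t.
Proof.
move=> ht.
pose e x1 x2 x3 :=
  sgnz R ((p - 1) * wt x1 + (q + 1 - 1) * (wt x1 + wt x2 + wt x3 + p)).
transitivity (
    cut5 (fun x1 x2 x3 x4 x5 => cut3 (fun y1 y2 y3 => (sgnz R p * e x1 x2 x3) *: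
      mu_ext (unzip2 (x1 ++ F x2 :: x3) ++
           sgnz R (wt y1) *: g (unzip2 (y1 ++ M y2 :: y3)) :: unzip2 x5)) x4) t
  + cut5 (fun x1 x2 x3 x4 x5 => cut3 (fun y1 y2 y3 => (sgnz R p * e x1 x2 x3) *:
      mu_ext (unzip2 (x1 ++ F x2 :: x3) ++
           sgnz R ((q - 1) * (wt y1 + 1) + 1) *:
             mu_ext (unzip2 (y1 ++ G y2 :: y3)) :: unzip2 x5)) x4) t).
  rewrite -cut5D [LHS](cut5_morph (scalerDr (sgnz R p))).
  apply: eq_cut5_in => x1 x2 x3 x4 x5 eq_t.
  have hx4 : homogeneous x4.
    by move: ht; rewrite eq_t !homogeneous_cat => /and5P[].
  rewrite -!(cut3_morph (mu_ext_slotD _ _ _)) -mu_ext_slotD.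
  rewrite -/(beta_word q g x4).
  rewrite -(beta_hom hg hx4) scalerA; congr (_ *: mu_ext _).
  by rewrite !unzip2E -catA.
rewrite (cut5_refine3_4th (fun x1 x2 x3 x4 y1 y2 y3 x5 => _)).
rewrite (cut5_refine3_4th (fun x1 x2 x3 x4 y1 y2 y3 x5 => _)).
rewrite (cut7_morph (@opprD A)).
congr (_ + _); apply: eq_cut7 => x1 x2 x3 x4 x5 x6 x7; rewrite /e /rel_sign.
  by koszul.
by koszul.
Qed.

(** On the left, the inner [mu] lies inside [f], inside [g] or outside both,
    and there are the terms with the whole cup product inside [mu].  The terms
    with [mu] inside [f] or [g] occur on the right; those that remain on either
    side are the six sums of [mu_ext_ainf_FG]. *)
Lemma beta_word_cup t : homogeneous t ->
  beta_word (p + q) (cup p q f g) t =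
  cup_word (p + 1) q (beta p f) g t
  + sgnz R p *: cup_word p (q + 1) f (beta q g) t.
Proof.
move=> ht; rewrite cup_word_beta_l // cup_word_beta_r //.
pose E x1 x2 x3 x4 x5 : A :=
  sgnz R ((p - 1) * wt x1 + (q - 1) * (wt x1 + wt x2 + wt x3 + p)) *:
    m (x1 ++ F x2 :: x3 ++ G x4 :: x5).
have -> : beta_word (p + q) (cup p q f g) t =
    cut3 (fun x y z => cut5 (fun x1 x2 x3 x4 x5 =>
      sgnz R (wt x) *: E x1 x2 x3 x4 x5) (x ++ M y :: z)) t
  + cut7 (fun x1 x2 x3 x4 x5 x6 x7 => rel_sign (x1 ++ x2) x3 x4 *:
      (sgnz R (wt x1) *: m (x1 ++ M (x2 ++ F x3 :: x4 ++ G x5 :: x6) :: x7))) t.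
  congr (_ + _).
    apply: eq_cut3_in => x y z eq_t.
    rewrite -(cut5_morph (scalerDr _)) -/(cup_word p q f g _) -cup_hom //.
    move: ht; rewrite eq_t !homogeneous_cat /= => /and3P[-> hy ->].
    by rewrite (letter_hom mu_ext_CH hy).
  transitivity (cut3 (fun x y z => cut5 (fun y1 y2 y3 y4 y5 =>
    sgnz R ((p + q - 1) * (wt x + 1) + 1) *:
      mu_ext (unzip2 x ++ E y1 y2 y3 y4 y5 :: unzip2 z)) y) t).
    apply: eq_cut3_in => x y z eq_t.
    have hy : homogeneous y.
      by move: ht; rewrite eq_t !homogeneous_cat => /and3P[].
    rewrite -(cut5_morph (mu_ext_slotD _ _ _)).
    rewrite -/(cup_word p q f g y) -cup_hom //.
    by rewrite unzip2E.
  rewrite cut3_cut5_mid; apply: eq_cut7 => x1 x2 x3 x4 x5 x6 x7.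
  by rewrite /E /rel_sign; koszul.
rewrite (cut3_cut5 M (fun x x1 x2 x3 x4 x5 =>
  sgnz R (wt x) *: E x1 x2 x3 x4 x5)).
have cancel (a b c d e k fm gm a' d' k' : A) :
    a + b + c + d + e + k = 0 -> a' = a -> d' = d -> k' = k ->
    a' + fm + d' + gm + k' + c = fm - b + (gm - e).
  move=> rel -> -> ->; apply: (addIr (b + e)).
  rewrite [LHS](AC (6*2) ((2*4)*(1*7*6*3*8*5))) /= rel.
  by rewrite [RHS](AC (2*2*2) ((1*3)*((2*5)*(4*6)))) /= !addNr !addr0.
apply: cancel (mu_ext_ainf_FG ht) _ _ _; apply: eq_cut7 => x1 x2 x3 x4 x5 x6 x7;
  rewrite /E /rel_sign.
- by koszul.
- by koszul.
- by koszul.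
Qed.

End Leibniz.

Theorem theorem4p2 (R : comPzRingType) (A : ainfAlgebra R) (p q : int)
    (f g : seq A -> A) (hf : CH p f) (hg : CH q g) :
  CH (p + q) (cup p q f g) /\
  (forall a : seq A,
     beta (p + q) (cup p q f g) a =
     cup (p + 1) q (beta p f) g a + sgnz R p *: cup p (q + 1) f (beta q g) a).
Proof.
split=> [|a]; first exact: cup_CH.
rewrite beta_linext; last exact: CH_kills0 (cup_CH hf hg).
rewrite !cup_linext [RHS]addrC -linext_linear; apply: eq_linext_hom => t ht _.
by rewrite beta_word_cup // [RHS]addrC.
Qed.
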